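(* Let $X$ be a zero primitive homogeneous topological exponential vector space over the field $\mathbb K$ of real or complex numbers, with additive identity $\theta$. For all $x,y\in X\setminus\{\theta\}$: (i) $x,y$ are orderly dependent iff $C_x(y)>0$ or $C_y(x)>0$; (ii) $x,y$ are orderly independent iff $C_x(y)=0=C_y(x)$; (iii) $C_x(y)>0\iff y\in L(x)\iff L(y)\subseteq L(x)$; (iv) $L(x)=L(y)$ iff $C_x(y)\,C_y(x)>0$; (v) $C_x(y)=0=C_y(x)$ iff $L(x)$ and $L(y)$ are incomparable (neither is contained in the other).
   Context: An exponential vector space (evs) over a field $K$ is a partially ordered set $(X,\le)$ with a binary operation $+$ and a scalar multiplication $\cdot:K\times X\to X$ such that: ($A_1$) $(X,+)$ is a commutative semigroup with identity $\theta$; ($A_2$) $x\le y$ implies $x+z\le y+z$ and $\alpha x\le\alpha y$ for all $z\in X$, $\alpha\in K$; ($A_3$) (i) $\alpha(x+y)=\alpha x+\alpha y$; (ii) $\alpha(\beta x)=(\alpha\beta)x$; (iii) $(\alpha+\beta)x\le\alpha x+\beta x$; (iv) $1x=x$; ($A_4$) $\alpha x=\theta$ iff $\alpha=0$ or $x=\theta$; ($A_5$) $x+(-1)x=\theta$ iff $x\in X_0$, where $X_0$ is the set of minimal elements of $X$; ($A_6$) for each $x\in X$ there is $p\in X_0$ with $p\le x$. A topological evs is an evs over $\mathbb K$ with a topology for which addition and scalar multiplication are continuous ($\mathbb K$ with its usual topology) and the graph $\{(x,y):x\le y\}$ is closed in $X\times X$. An evs is zero primitive if $\{p\in X_0:p\le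 x\}=\{\theta\}$ for all $x\in X$ (so $X_0=\{\theta\}$). It is homogeneous if $\alpha x=|\alpha|x$ for all $\alpha\in\mathbb K$ and $x\in X$. For $x\in X\setminus X_0$, $L(x):=\{z\in X:z\ge\alpha x+p\text{ for some }\alpha\in\mathbb K\setminus\{0\},\ p\in X_0\}$. Elements $x,y\in X\setminus X_0$ are orderly dependent if $x\in L(y)$ or $y\in L(x)$, and orderly independent otherwise. In a zero primitive topological evs, for $x\ne\theta$ and $y\in X$ the comparing spectrum is $\sigma_x(y):=\{\lambda\in\mathbb K:\lambda x\le y\}$, which is non-empty and (a known fact) bounded, and the comparing function relative to $x$ is $C_x(y):=\sup_{\lambda\in\sigma_x(y)}|\lambda|\in[0,\infty)$. *)

(* Defs.v *)
From HB Require Import structures.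
From mathcomp Require Import all_boot all_order all_algebra.
From mathcomp Require Import complex.
From mathcomp Require Import all_classical all_reals all_analysis.
Import Order.TTheory GRing.Theory Num.Theory.
Import numFieldNormedType.Exports.

Set Implicit Arguments.
Unset Strict Implicit.
Unset Printing Implicit Defensive.

Local Open Scope classical_set_scope.
Local Open Scope ring_scope.

Definition minimal_elements T (le : rel T) : set T :=
  [set x | forall y : T, le y x -> y = x].

(* The scalar multiplication is a new operation: an exponential vector space is
   not a (semi)module, since only (a + b) x <= a x + b x is required.  The order
   is part of this mixin, and not inherited from porderType, because
   Hierarchy-Builder admits no further join of POrder and Nmodule once
   Num.POrderedZmodule is declared. *)
HB.mixin Record isEVS (K : fieldType) X & GRing.Nmodule X := {
  evs_le : rel X;
  evs_scale : K -> X -> X;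
  evs_le_refl : reflexive evs_le;
  evs_le_anti : antisymmetric evs_le;
  evs_le_trans : transitive evs_le;
  evs_leD : forall x y z : X, evs_le x y -> evs_le (x + z) (y + z);
  evs_leZ : forall (a : K) (x y : X),
    evs_le x y -> evs_le (evs_scale a x) (evs_scale a y);
  evs_scaleDr : forall (a : K) (x y : X),
    evs_scale a (x + y) = evs_scale a x + evs_scale a y;
  evs_scaleA : forall (a b : K) (x : X),
    evs_scale a (evs_scale b x) = evs_scale (a * b) x;
  evs_scaleDl_le : forall (a b : K) (x : X),
    evs_le (evs_scale (a + b) x) (evs_scale a x + evs_scale b x);
  evs_scale1 : forall x : X, evs_scale 1 x = x;
  evs_scale_eq0 : forall (a : K) (x : X),
    evs_scale a x = 0 <-> a = 0 \/ x = 0;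
  evs_subrr : forall x : X,
    x + evs_scale (-1) x = 0 <-> minimal_elements evs_le x;
  evs_minimal_le : forall x : X,
    exists2 p : X, minimal_elements evs_le p & evs_le p x
}.

#[short(type="evsType")]
HB.structure Definition EVS (K : fieldType) :=
  {X of isEVS K X & GRing.Nmodule X}.

Reserved Notation "a *:e x" (at level 40, left associativity).
Reserved Notation "x <=e y" (at level 70, no associativity).
Notation "a *:e x" := (evs_scale a x) : ring_scope.
Notation "x <=e y" := (evs_le x y) : ring_scope.

HB.mixin Record EVS_isTopological (K : numFieldType) X
    & EVS K X & TopologicalNmodule X := {
  evs_scale_continuous : continuous (fun z : K^o * X => z.1 *:e z.2 : X);
  evs_le_closed : closed [set z : X * X | z.1 <=e z.2]
}.

#[short(type="topologicalEvsType")]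
HB.structure Definition TopologicalEVS (K : numFieldType) :=
  {X of EVS K X & TopologicalNmodule X & EVS_isTopological K X}.

Section evs.
Context (K : fieldType) (X : evsType K).
Implicit Types x y : X.

(* The set X_0 of minimal elements of X. *)
Definition primitives : set X := minimal_elements (@evs_le K X).

Definition zero_primitive : Prop :=
  forall x, [set p | primitives p /\ p <=e x] = [set 0].

Definition L x : set X :=
  [set z | exists (a : K) (p : X),
     [/\ a != 0, primitives p & a *:e x + p <=e z]].

(* These two notions are only meant for elements that are not minimal. *)
Definition orderly_dependent x y : Prop := L y x \/ L x y.
Definition orderly_independent x y : Prop := ~ orderly_dependent x y.

Definition comparing_spectrum x y : set K := [set a | a *:e x <=e y].

End evs.

Definition homogeneous (K : numFieldType) (X : evsType K) : Prop :=
  forall (a : K) (x : X), a *:e x = `|a| *:e x.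

Variant scalar_kind := RealScalars | ComplexScalars.

Definition scalar_field (R : realType) (k : scalar_kind) : numFieldType :=
  match k with RealScalars => R | ComplexScalars => R[i] end.

(* The norm `|z| of a numFieldType lies in the field itself; suprema need the
   real-valued modulus. *)
Definition modulus (R : realType) (k : scalar_kind) : scalar_field R k -> R :=
  match k with
  | RealScalars => fun a : R => `|a|
  | ComplexScalars => fun z : R[i] => Normc.normc z
  end.

Definition comparing_function (R : realType) (k : scalar_kind)
    (X : evsType (scalar_field R k)) (x y : X) : R :=
  sup [set modulus a | a in comparing_spectrum x y].

(* Main.v *)
Require Import Defs.
From HB Require Import structures.
From mathcomp Require Import all_boot all_order all_algebra.
From mathcomp Require Import complex.
From mathcomp Require Import all_classical all_reals all_analysis.
Import Order.TTheory GRing.Theory Num.Theory.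
Import numFieldNormedType.Exports.

Local Open Scope classical_set_scope.
Local Open Scope ring_scope.

Set Implicit Arguments.
Unset Strict Implicit.

(** Since [0] is the only primitive, [y] lies in [L x] exactly when some nonzero scalar belongs to
    the comparing spectrum of [y] relative to [x] ([LP]). A supremum of moduli is positive exactly
    when some modulus is, so [L x y] amounts to [0 < comparing_function x y]
    ([comparing_function_gt0]); this requires the spectrum to be bounded, which is where the
    topology enters ([comparing_spectrum_bounded]). Moreover [L] is a preorder, so [L x y] also
    means that [L y] is contained in [L x] ([sub_L]). The five claims are then propositional
    consequences. *)

Section zero_primitive_evs.
Context (K : fieldType) (X : evsType K).
Hypothesis X0 : zero_primitive X.
Implicit Types x y z : X.

Lemma primitives_eq0 (p : X) : primitives p -> p = 0.
Proof.
move=> pp; suff : [set q | primitives q /\ q <=e p] p by rewrite (X0 p).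
by split=> //; exact: evs_le_refl.
Qed.

Lemma primitives0 : @primitives K X 0.
Proof. by have : [set 0 : X] 0 by []; rewrite -(X0 0) => -[]. Qed.

Lemma evs_ge0 x : 0 <=e x.
Proof. by have : [set 0 : X] 0 by []; rewrite -(X0 x) => -[]. Qed.

Lemma LP x z : L x z <-> exists2 a : K, a != 0 & a *:e x <=e z.
Proof.
split=> [[a [p [a0 /primitives_eq0 ->]]]|[a a0 le_ax_z]].
  by rewrite addr0; exists a.
by exists a, 0; split=> //; [exact: primitives0 | rewrite addr0].
Qed.

Lemma L_refl x : L x x.
Proof.
by apply/LP; exists 1; [exact: oner_neq0 | rewrite evs_scale1 evs_le_refl].
Qed.

(** Scaling [a *:e x <=e y] by [b] and chaining it with [b *:e y <=e z] gives the scalar [b * a],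
    nonzero in a field. *)
Lemma L_trans y x z : L x y -> L y z -> L x z.
Proof.
move=> /LP[a a0 axy] /LP[b b0 byz]; apply/LP; exists (b * a).
  by rewrite mulf_neq0.
by rewrite -evs_scaleA; apply: evs_le_trans byz; exact: evs_leZ.
Qed.

Lemma sub_L x y : L y `<=` L x <-> L x y.
Proof.
split=> [|Lxy z]; first by apply; exact: L_refl.
exact: L_trans.
Qed.

End zero_primitive_evs.

Section modulus.
Context (R : realType) (k : scalar_kind).
Implicit Types a b : scalar_field R k.

(** In the complex case the norm of [a] is the image of [modulus a] under the embedding of [R] into
    [R[i]], which preserves and reflects the order; the next two lemmas rest on this too. *)
Lemma modulus_ge0 a : 0 <= modulus a.
Proof. by case: k a => a; rewrite ?normr_ge0 // -lecR (normr_ge0 a). Qed.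

Lemma modulus_gt0 a : (0 < modulus a) = (a != 0).
Proof. by case: k a => a; rewrite ?normr_gt0 // -ltcR (normr_gt0 a). Qed.

Lemma le_modulus a b : `|a| <= `|b| -> modulus a <= modulus b.
Proof. by case: k a b => a b //; rewrite -lecR. Qed.

End modulus.

Lemma continuous_pair (T U V : topologicalType) (f : T -> U) (g : T -> V) :
  continuous f -> continuous g -> continuous (fun t => (f t, g t)).
Proof. by move=> cf cg t; exact: (cvg_pair (cf t) (cg t)). Qed.

(* If [a *: x <= y] with [a] large, then [x <= a^-1 *: y] with [a^-1] near [0]:
   as the order is closed and [0 *: y = 0], this would give [x <= 0]. *)
Lemma comparing_spectrum_bounded (K : numFieldType) (X : topologicalEvsType K)
    (x y : X) :
  zero_primitive X -> x <> 0 ->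
  exists M : K, forall a, comparing_spectrum x y a -> `|a| <= `|M|.
Proof.
move=> X0 x0.
pose f (a : K^o) : X * X := (x, (a : K) *:e y).
have cf : continuous f.
  apply: (@continuous_pair K^o X X (cst x)); first exact: (@cst_continuous K^o).
  move=> a; apply: (@continuous_comp _ _ _ (fun a : K^o => (a, y))
    (fun z : K^o * X => (z.1 : K) *:e z.2)); last exact: evs_scale_continuous.
  apply: (@continuous_pair K^o K^o X id (cst y)); last first.
    exact: (@cst_continuous K^o).
  by move=> b; exact: cvg_id.
have oA : open (~` [set a : K^o | x <=e (a : K) *:e y]).
  rewrite openC.
  exact: (closed_comp (f := f) (fun a _ => cf a) (@evs_le_closed K X)).
have A0 : (~` [set a : K^o | x <=e (a : K) *:e y]) 0.
  rewrite /= (_ : 0 *:e y = 0); last by apply/evs_scale_eq0; left.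
  by move=> x_le0; apply/x0/evs_le_anti; rewrite x_le0 evs_ge0.
have /nbhs_ballP[e /= e_gt0 eA] := open_nbhs_nbhs (conj oA A0).
(* Here [e] is the radius of a ball around [0] containing no [b] with [x <=e b *:e y]; a scalar [a]
   of norm above [e^-1] would put [a^-1] in that ball. *)
exists e^-1 => a; rewrite /comparing_spectrum/= => le_ax_y.
have [->|a0] := eqVneq a 0; first by rewrite normr0.
rewrite normfV (gtr0_norm e_gt0) -[`|a|]invrK.
rewrite lef_pV2 ?posrE ?invr_gt0 ?normr_gt0//.
rewrite -normfV real_leNgt ?normr_real ?gtr0_real//; apply/negP => lt_ae.
have /eA : ball (0 : K^o) e (a^-1 : K^o) by rewrite -ball_normE /= sub0r normrN.
apply; rewrite /= -[x]evs_scale1 -(mulVf a0) -evs_scaleA.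
exact: evs_leZ.
Qed.

Section comparing_function.
Context (R : realType) (k : scalar_kind).
Context (X : topologicalEvsType (scalar_field R k)).
Hypothesis X0 : zero_primitive X.
Implicit Types x y : X.

Let moduli x y := [set modulus a | a in comparing_spectrum x y].

(** [sup] behaves as a supremum only on nonempty bounded sets. The scalar [0] is always in the
    spectrum, because [0 *:e x = 0] lies below everything. *)
Lemma has_sup_moduli x y : x <> 0 -> has_sup (moduli x y).
Proof.
move=> x0; split.
  exists (modulus (0 : scalar_field R k)), 0 => //; rewrite /comparing_spectrum/=.
  by rewrite (_ : 0 *:e x = 0) ?evs_ge0//; apply/evs_scale_eq0; left.
have [M leM] := comparing_spectrum_bounded y X0 x0.
(* The bound [M] lives in the scalar field; [le_modulus] carries it over to [R]. *)
by exists (modulus M) => _ [a /leM /le_modulus ? <-].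
Qed.

Lemma comparing_function_ge0 x y : x <> 0 -> 0 <= comparing_function x y.
Proof.
move=> /(@has_sup_moduli _ y)[[_ [a axy _]] ubxy].
by apply: le_trans (modulus_ge0 a) (ub_le_sup ubxy _); exists a.
Qed.

Lemma comparing_function_gt0 x y :
  x <> 0 -> 0 < comparing_function x y <-> L x y.
Proof.
move=> x0; have supxy := has_sup_moduli y x0; rewrite LP//; split.
  move=> /(sup_gt supxy.1) [_ [a axy <-]]; rewrite modulus_gt0 => a0.
  by exists a.
move=> [a a0 axy]; apply: (@lt_le_trans _ _ (modulus a)).
  by rewrite modulus_gt0.
by apply: ub_le_sup; [exact: supxy.2 | exists a].
Qed.

Lemma comparing_function_eq0 x y :
  x <> 0 -> comparing_function x y = 0 <-> ~ L x y.
Proof.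
move=> x0; rewrite -comparing_function_gt0//.
have := @comparing_function_ge0 x y x0; rewrite le_eqVlt => /orP[/eqP <-|C_gt0].
  by rewrite ltxx.
by split=> [C0|/(_ C_gt0)//]; rewrite C0 ltxx in C_gt0.
Qed.

End comparing_function.

Theorem theorem5p6 (R : realType) (k : scalar_kind)
    (X : topologicalEvsType (scalar_field R k))
    (X_zero_primitive : zero_primitive X) (X_homogeneous : homogeneous X)
    (x y : X) (x_neq0 : x <> 0) (y_neq0 : y <> 0) :
  [/\ orderly_dependent x y <->
        0 < comparing_function x y \/ 0 < comparing_function y x,
      orderly_independent x y <->
        comparing_function x y = 0 /\ comparing_function y x = 0,
      (0 < comparing_function x y <-> L x y) /\
        (L x y <-> L y `<=` L x),
      L x = L y <-> 0 < comparing_function x y * comparing_function y x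
    & comparing_function x y = 0 /\ comparing_function y x = 0 <->
        ~ L x `<=` L y /\ ~ L y `<=` L x].
Proof.
have Cxy := comparing_function_gt0 X_zero_primitive y x_neq0.
have Cyx := comparing_function_gt0 X_zero_primitive x y_neq0.
have C0xy := comparing_function_eq0 X_zero_primitive y x_neq0.
have C0yx := comparing_function_eq0 X_zero_primitive x y_neq0.
have subL := sub_L X_zero_primitive.
split.
- by rewrite /orderly_dependent Cxy Cyx; tauto.
- by rewrite /orderly_independent /orderly_dependent C0xy C0yx; tauto.
- by split=> //; rewrite subL.
(* Both factors are nonnegative, so a positive product, having nonzero factors, has positive
   ones. *)
- have -> : 0 < comparing_function x y * comparing_function y x <->
      L x y /\ L y x.
    rewrite -Cxy -Cyx; split=> [|[]]; last exact: mulr_gt0.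
    rewrite lt0r mulf_eq0 negb_or => /andP[/andP[Cxy0 Cyx0] _].
    by rewrite !lt0r Cxy0 Cyx0 !comparing_function_ge0.
  by rewrite eqEsubset !subL; tauto.
- by rewrite C0xy C0yx !subL; tauto.
Qed.
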